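(* Let $r(s)$, $L_1\le s\le L_2$, be a regular curve in $\mathbb{R}^3$ parametrized by arc length. Then there exists a ruled surface $P(s,t)$ possessing $r(s)$ as an asymptotic curve.
   Context: A ruled surface here is a surface of the form $P(s,t)=r(s)+(t-t_0)\,d(s)$ with $d(s)\in\mathbb{R}^3$ giving the ruling direction, so that $r(s)=P(s,t_0)$. A curve on a surface is asymptotic if its velocity is always a direction of zero normal curvature; for $r(s)=P(s,t_0)$ this is expressed as $\frac{\partial n}{\partial s}(s,t_0)\cdot r'(s)=0$ for all $s$, where $n(s,t)=\frac{\partial P}{\partial s}\times\frac{\partial P}{\partial t}$ is the surface normal. *)

(* Defs.v *)
From HB Require Import structures.
From mathcomp Require Import all_boot all_order all_algebra.
From mathcomp Require Import all_classical all_reals all_analysis.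
Set Implicit Arguments.
Unset Strict Implicit.
Unset Printing Implicit Defensive.
Import Order.TTheory GRing.Theory Num.Theory.
Import numFieldNormedType.Exports.
Local Open Scope ring_scope.
Local Open Scope classical_set_scope.

Definition dotv (R : realType) (u v : 'rV[R]_3) : R := (u *m v^T) ord0 ord0.

(* The canonical norm `|u| on 'rV[R]_3 is the sup norm, not this one. *)
Definition enorm (R : realType) (u : 'rV[R]_3) : R := Num.sqrt (dotv u u).

(* Addition in 'I_3 is modulo 3, so k + 1 and k + 2 run cyclically. *)
Definition crossv (R : realType) (u v : 'rV[R]_3) : 'rV[R]_3 :=
  \row_(k < 3) (u ord0 (k + 1) * v ord0 (k + 2%:R)
              - u ord0 (k + 2%:R) * v ord0 (k + 1)).

(* C^oo on the closed interval [a, b] means C^oo on an open interval that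
   contains it; the derivatives at a and b are then the usual two-sided ones
   and depend only on the values of f on [a, b]. *)
Definition smooth_on (R : realType) (a b : R) (f : R -> 'rV[R]_3) : Prop :=
  exists2 e : R, 0 < e &
    forall (n : nat) (s : R), a - e < s < b + e -> derivable (derive1n n f) s 1.

Definition regular_curve (R : realType) (a b : R) (r : R -> 'rV[R]_3) : Prop :=
  smooth_on a b r /\ (forall s : R, a <= s <= b -> derive1 r s != 0).

Definition arc_length_param (R : realType) (a b : R) (r : R -> 'rV[R]_3) : Prop :=
  forall s : R, a <= s <= b -> enorm (derive1 r s) = 1.

Definition partial_s (R : realType) (P : R -> R -> 'rV[R]_3) (s t : R) : 'rV[R]_3 :=
  derive1 (fun x : R => P x t) s.

Definition partial_t (R : realType) (P : R -> R -> 'rV[R]_3) (s t : R) : 'rV[R]_3 :=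
  derive1 (P s) t.

Definition surface_normal (R : realType) (P : R -> R -> 'rV[R]_3) (s t : R)
    : 'rV[R]_3 :=
  crossv (partial_s P s t) (partial_t P s t).

Definition ruled_surface (R : realType) (a b : R) (r : R -> 'rV[R]_3) (t0 : R)
    (P : R -> R -> 'rV[R]_3) : Prop :=
  exists d : R -> 'rV[R]_3,
    [/\ smooth_on a b d,
        forall s : R, a <= s <= b -> d s != 0
      & forall s t : R, P s t = r s + (t - t0) *: d s].

Definition asymptotic_curve (R : realType) (a b t0 : R)
    (P : R -> R -> 'rV[R]_3) (r : R -> 'rV[R]_3) : Prop :=
  (forall s : R, a <= s <= b -> r s = P s t0) /\
  (forall s : R, a <= s <= b ->
     dotv (partial_s (surface_normal P) s t0) (derive1 r s) = 0).

Definition straight (R : realType) (a b : R) (r : R -> 'rV[R]_3) : Prop :=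
  forall s : R, a <= s <= b -> derive1n 2 r s = 0.

(* The asymptotic condition holds trivially where the normal vanishes, so the
   normal is required to be nonzero along r. A zero of r'' on a curve that is
   not straight is excepted: r need not have a limiting osculating plane there,
   and for some smooth r no surface with r as an asymptotic curve is regular
   at such a point. *)
Definition nondegenerate_along (R : realType) (a b t0 : R)
    (P : R -> R -> 'rV[R]_3) (r : R -> 'rV[R]_3) : Prop :=
  forall s : R, a <= s <= b -> straight a b r \/ derive1n 2 r s != 0 ->
    surface_normal P s t0 != 0.

(* Main.v *)
(** Along [r] the normal of [r s + (t - t0) *: d s] is [r' x d], so [r] is
    asymptotic exactly when [det (r', r'', d) = 0]. Unit speed makes [r'']
    orthogonal to [r'], hence [d = r' + r''] is smooth, never vanishes, and
    gives the normal [r' x r''], which is nonzero wherever [r''] is. A straight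
    [r] has constant [r'], and any constant [d] not parallel to it works. *)
Require Import Defs.
From HB Require Import structures.
From mathcomp Require Import all_boot all_order all_algebra.
From mathcomp Require Import all_classical all_reals all_analysis.
From mathcomp Require Import ring lra.
Import Order.TTheory GRing.Theory Num.Theory.
Import numFieldNormedType.Exports.
Local Open Scope ring_scope.

(** * Algebra of the dot and cross products *)

Lemma dotvE (R : realType) (u v : 'rV[R]_3) :
  dotv u v = u ord0 0 * v ord0 0 + u ord0 1 * v ord0 1 + u ord0 2%:R * v ord0 2%:R.
Proof.
rewrite /dotv mxE !big_ord_recl big_ord0 addr0 !mxE addrA.
by congr (_ + _ + _); congr (u _ _ * v _ _); apply: val_inj.
Qed.

Lemma crossvE (R : realType) (u v : 'rV[R]_3) :
  [/\ crossv u v ord0 0 = u ord0 1 * v ord0 2%:R - u ord0 2%:R * v ord0 1,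
      crossv u v ord0 1 = u ord0 2%:R * v ord0 0 - u ord0 0 * v ord0 2%:R
    & crossv u v ord0 2%:R = u ord0 0 * v ord0 1 - u ord0 1 * v ord0 0].
Proof.
by split; rewrite mxE; congr (u _ _ * v _ _ - u _ _ * v _ _); apply: val_inj.
Qed.

Lemma ord3_ind (P : 'I_3 -> Prop) : P 0 -> P 1 -> P 2%:R -> forall i, P i.
Proof.
move=> P0 P1 P2 [[|[|[|//]]] lti].
- by rewrite (_ : Ordinal _ = 0) //; apply: val_inj.
- by rewrite (_ : Ordinal _ = 1) //; apply: val_inj.
- by rewrite (_ : Ordinal _ = 2%:R) //; apply: val_inj.
Qed.

Lemma dotvv_eq0 (R : realType) (u : 'rV[R]_3) : (dotv u u == 0) = (u == 0).
Proof.
apply/eqP/eqP => [|->]; last by rewrite /dotv mul0mx mxE.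
rewrite dotvE => u0; apply/rowP => i; rewrite mxE; apply/eqP.
(* Each squared coordinate is at most the sum of the three squares, which is 0. *)
rewrite -sqrf_eq0 -normr_le0; move: i; apply: ord3_ind;
  rewrite ger0_norm ?sqr_ge0 //; nra.
Qed.

Lemma dotvDr (R : realType) (u v w : 'rV[R]_3) :
  dotv u (v + w) = dotv u v + dotv u w.
Proof. by rewrite /dotv raddfD /= mulmxDr mxE. Qed.

Lemma dotv0 (R : realType) (u : 'rV[R]_3) : dotv u 0 = 0.
Proof. by rewrite /dotv trmx0 mulmx0 mxE. Qed.

Lemma dotvC (R : realType) (u v : 'rV[R]_3) : dotv u v = dotv v u.
Proof. by rewrite !dotvE; ring. Qed.

Lemma dotv_crossvl (R : realType) (u v : 'rV[R]_3) : dotv (crossv u v) u = 0.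
Proof. by rewrite dotvE; case: (crossvE _ u v) => -> -> ->; ring. Qed.

Lemma crossvDr (R : realType) (u v w : 'rV[R]_3) :
  crossv u (v + w) = crossv u v + crossv u w.
Proof. by apply/rowP => i; rewrite !mxE; ring. Qed.

Lemma crossvv (R : realType) (u : 'rV[R]_3) : crossv u u = 0.
Proof. by apply/rowP => i; rewrite !mxE; ring. Qed.

Lemma crossvC (R : realType) (u v : 'rV[R]_3) : crossv u v = - crossv v u.
Proof. by apply/rowP => i; rewrite !mxE; ring. Qed.

Lemma crossv0l (R : realType) (u : 'rV[R]_3) : crossv 0 u = 0.
Proof. by apply/rowP => i; rewrite !mxE; ring. Qed.

Lemma lagrange_crossv (R : realType) (u v : 'rV[R]_3) :
  dotv (crossv u v) (crossv u v) = dotv u u * dotv v v - dotv u v ^+ 2.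
Proof. by rewrite !dotvE; case: (crossvE _ u v) => -> -> ->; ring. Qed.

(** For orthogonal vectors the Lagrange identity reduces [|u x v|^2] to [|u|^2 |v|^2]. *)
Lemma crossv_orthogonal_neq0 (R : realType) (u v : 'rV[R]_3) :
  u != 0 -> v != 0 -> dotv u v = 0 -> crossv u v != 0.
Proof.
move=> u0 v0 uv0; rewrite -dotvv_eq0 lagrange_crossv uv0 expr0n subr0.
by rewrite mulf_neq0 // dotvv_eq0.
Qed.

Lemma exists_crossv_neq0 (R : realType) (u : 'rV[R]_3) :
  u != 0 -> exists v : 'rV[R]_3, crossv u v != 0.
Proof.
move=> u0; apply: contrapT => /forallNP uv.
suff: u = 0 by move/eqP; apply/negP.
have e k : crossv u (delta_mx ord0 k) = 0.
  by have /negP := uv (delta_mx ord0 k); rewrite negbK => /eqP.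
(* Two basis vectors suffice: [u x e_0 = (0, u_2, -u_1)] and [u x e_1 = (-u_2, 0, u_0)] together
   show every coordinate of [u]. *)
have [_ u2 u1] := crossvE _ u (delta_mx ord0 0).
have [u2' _ u0'] := crossvE _ u (delta_mx ord0 1).
move: u2 u1 u0'; rewrite !e !mxE /= => u2 u1 u0'.
by apply/rowP; apply: ord3_ind; rewrite mxE; lra.
Qed.

(** * Differentiation of vector functions and smoothness on an interval *)

Section Derivatives.
Local Open Scope classical_set_scope.

Lemma is_derive_coord (R : realType) n (f : R -> 'rV[R]_n) (s : R) (j : 'I_n) :
  derivable f s 1 ->
  is_derive s 1 (fun x => f x ord0 j) (derive1 f s ord0 j).
Proof.
move=> df; apply: DeriveDef; first by move/derivable_mxP: df.
by rewrite derive1E derive_mx // mxE.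
Qed.

Lemma derive1_row (R : realType) n (f : R -> 'rV[R]_n) (s : R) (v : 'rV[R]_n) :
  (forall j, is_derive s 1 (fun x => f x ord0 j) (v ord0 j)) ->
  derive1 f s = v.
Proof.
move=> df; have ? : derivable f s 1.
  by apply/derivable_mxP => i j; rewrite (ord1 i); exact: ex_derive.
by rewrite derive1E derive_mx //; apply/rowP => j; rewrite mxE; exact: derive_val.
Qed.

Lemma derive1_crossv (R : realType) (u v : R -> 'rV[R]_3) (s : R) :
  derivable u s 1 -> derivable v s 1 ->
  derive1 (fun x => crossv (u x) (v x)) s =
  crossv (derive1 u s) (v s) + crossv (u s) (derive1 v s).
Proof.
move=> du dv.
apply: derive1_row => j.
have h k := is_derive_coord _ _ u s k du; have h' k := is_derive_coord _ _ v s k dv.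
(* Written with operations on functions, the coordinate has the shape from which [is_derive]
   instances are inferred. *)
rewrite (_ : (fun x => _) =
  (fun x => u x ord0 (j + 1) * v x ord0 (j + 2%:R)) -
  (fun x => u x ord0 (j + 2%:R) * v x ord0 (j + 1))); last first.
  by apply/funext => x; rewrite mxE.
apply: is_derive_eq; rewrite !mxE /GRing.scale /=; ring.
Qed.

Lemma is_derive_dotv (R : realType) (u v : R -> 'rV[R]_3) (s : R) :
  derivable u s 1 -> derivable v s 1 ->
  is_derive s 1 (fun x => dotv (u x) (v x))
    (dotv (derive1 u s) (v s) + dotv (u s) (derive1 v s)).
Proof.
move=> du dv.
have h k := is_derive_coord _ _ u s k du; have h' k := is_derive_coord _ _ v s k dv.
rewrite (_ : (fun x => _) =
  (fun x => u x ord0 0 * v x ord0 0) + (fun x => u x ord0 1 * v x ord0 1) +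
  (fun x => u x ord0 2%:R * v x ord0 2%:R)); last first.
  by apply/funext => x; rewrite dotvE.
apply: is_derive_eq; rewrite !dotvE /GRing.scale /=; ring.
Qed.

(* The endpoints are covered by the one-sided difference quotients. *)
Lemma derive1_eq0_itv (R : realType) (f : R -> R) (a b c s : R) :
  a < b -> a <= s <= b ->
  (forall x, a <= x <= b -> f x = c) -> derivable f s 1 -> derive1 f s = 0.
Proof.
move=> ab /andP[as_ sb] fc df; rewrite derive1E.
have quot0 x : a <= x + s <= b -> x^-1 *: (f (x *: 1 + s) - f s) = 0.
  by move=> xs; rewrite [_ *: 1]mulr1 !fc ?subrr ?scaler0 ?as_.
pose q x := x^-1 *: (f (x *: 1 + s) - f s).
(* Along any proper filter whose increments keep [x + s] in [[a, b]] the quotient is eventually 0,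
   so its limit, the derivative, is 0. *)
have lims (F : set_system R) : ProperFilter F -> q x @[x --> F] --> 'D_1 f s ->
    (\forall x \near F, a <= x + s <= b) -> 'D_1 f s = 0.
  move=> FF qD Fab; apply: (cvg_unique _ qD); first exact: norm_hausdorff.
  by apply: cvg_near_cst; apply: filterS Fab => x /quot0.
(* Increments from the right stay in the interval unless [s = b]; there those from the left do,
   because [a < b]. *)
have [sltb|bs] := ltP s b.
- apply: (lims 0^'+); first exact: cvg_dnbhs_at_right df.
  near=> x; have : x <= b - s by near: x; apply: nbhs_right_le; rewrite subr_gt0.
  have : 0 < x by [].
  lra.
- have alts : a < s by lra.
  apply: (lims 0^'-); first exact: cvg_dnbhs_at_left df.
  near=> x; have : a - s <= x by near: x; apply: nbhs_left_ge; rewrite subr_lt0.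
  have : x < 0 by [].
  lra.
Unshelve. all: by end_near.
Qed.

(** Mean value theorem on [[a, s]]. *)
Lemma derive1_eq0_cst_itv (R : realType) (f : R -> R) (a b s : R) :
  a <= s <= b ->
  (forall x, a <= x <= b -> is_derive x 1 f 0) -> f s = f a.
Proof.
move=> /andP[as_ sb] df.
have := @MVT_segment _ f (fun=> 0) a s as_.
case.
- by move=> x; rewrite in_itv /= => /andP[ax xs]; apply: df; lra.
- apply: derivable_within_continuous => x; rewrite in_itv /= => /andP[ax xs].
  by have /df [] : a <= x <= b by lra.
- by move=> _ _ /eqP; rewrite mul0r subr_eq0 => /eqP.
Qed.

(** An open interval is used because the induction step differentiates the previous identity, which
    must hold near [s]. *)
Lemma derive1nD (R : realType) (V : normedModType R) (f g : R -> V) (a b : R) :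
  (forall n s, a < s < b -> derivable (derive1n n f) s 1) ->
  (forall n s, a < s < b -> derivable (derive1n n g) s 1) ->
  forall n s, a < s < b ->
  derive1n n (fun x => f x + g x) s = derive1n n f s + derive1n n g s.
Proof.
move=> df dg; elim=> [//|n IH] s sab.
rewrite !derive1nS !derive1E -deriveD; [|exact: df|exact: dg].
apply: near_eq_derive.
have : s \in `]a, b[%R by rewrite in_itv.
move=> /near_in_itvoo; apply: filterS => x; rewrite in_itv /=; exact: IH.
Qed.

Lemma smooth_on_add (R : realType) (f g : R -> 'rV[R]_3) (a b : R) :
  smooth_on a b f -> smooth_on a b g -> smooth_on a b (fun x => f x + g x).
Proof.
move=> [e e0 df] [e' e'0 dg].
exists (Num.min e e'); first by rewrite lt_min e0.
have le1 : Num.min e e' <= e by rewrite ge_min lexx.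
have le2 : Num.min e e' <= e' by rewrite ge_min lexx orbT.
have df' n s : a - Num.min e e' < s < b + Num.min e e' -> derivable (derive1n n f) s 1.
  by move=> ?; apply: df; lra.
have dg' n s : a - Num.min e e' < s < b + Num.min e e' -> derivable (derive1n n g) s 1.
  by move=> ?; apply: dg; lra.
move=> n s sab.
(* Derivability passes from the sum of the derivatives to the derivative of the sum, as the two
   agree near [s]. *)
apply: (@near_eq_derivable _ _ _ (derive1n n f + derive1n n g)).
  have : s \in `](a - Num.min e e'), (b + Num.min e e')[%R by rewrite in_itv.
  move=> /near_in_itvoo; apply: filterS => x; rewrite in_itv /= => xab.
  by rewrite (derive1nD _ _ _ _ _ _ df' dg').
by apply: derivableD; [exact: df'|exact: dg'].
Qed.

Lemma smooth_on_derive1n (R : realType) (f : R -> 'rV[R]_3) (a b : R) (k : nat) :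
  smooth_on a b f -> smooth_on a b (derive1n k f).
Proof.
move=> [e e0 df]; exists e; first by [].
move=> n s sab; have := df (n + k)%N s sab.
by rewrite /derive1n iterD; apply.
Qed.

Lemma smooth_on_cst (R : realType) (v : 'rV[R]_3) (a b : R) : smooth_on a b (fun=> v).
Proof.
(* The induction carries only constancy: the value is [v] at order 0 and 0 at every later order. *)
exists 1 => // n s _; suff [w ->] : exists w, derive1n n (fun _ : R => v) = fun=> w.
  exact: derivable_cst.
elim: n => [|n [w IH]]; first by exists v.
by exists 0; rewrite derive1nS IH; apply/funext => x; rewrite derive1_cst.
Qed.

Lemma smooth_on_derivable (R : realType) (f : R -> 'rV[R]_3) (a b s : R) :
  smooth_on a b f -> a <= s <= b -> derivable f s 1.
Proof. by move=> [e e0 /(_ 0%N s)] + /andP[? ?]; apply; lra. Qed.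

End Derivatives.

(** * Unit-speed curves, straight curves and ruled surfaces *)

Lemma arc_length_dotv (R : realType) (a b : R) (r : R -> 'rV[R]_3) s :
  arc_length_param a b r -> a <= s <= b -> dotv (derive1 r s) (derive1 r s) = 1.
Proof.
move=> /[apply]; rewrite /enorm => /(congr1 (fun x => x ^+ 2)).
rewrite sqr_sqrtr ?expr1n //.
by rewrite dotvE -!expr2 !addr_ge0 ?sqr_ge0.
Qed.

(** Differentiate [r' . r' = 1]. This identity is known only on [[a, b]], so [derive1_eq0_itv] is
    what covers the endpoints. *)
Lemma arc_length_dotv_derive2 (R : realType) (a b : R) (r : R -> 'rV[R]_3) s :
  a < b -> smooth_on a b r -> arc_length_param a b r -> a <= s <= b ->
  dotv (derive1 r s) (derive1n 2 r s) = 0.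
Proof.
move=> ab sr ar sab.
have dr : derivable (derive1 r) s 1.
  exact: smooth_on_derivable (smooth_on_derive1n _ _ _ _ 1 sr) sab.
have drr := is_derive_dotv _ _ _ _ dr dr.
have : derive1 (fun x => dotv (derive1 r x) (derive1 r x)) s = 0.
  apply: (derive1_eq0_itv _ _ a b 1) => //.
  by move=> x xab; exact: arc_length_dotv ar xab.
rewrite derive1E derive_val (dotvC _ (derive1 (derive1 r) s)).
by rewrite (_ : derive1n 2 r = derive1 (derive1 r)) // => ?; lra.
Qed.

(** Each coordinate of [r'] has zero derivative on the interval. *)
Lemma straight_derive1 (R : realType) (a b : R) (r : R -> 'rV[R]_3) s :
  smooth_on a b r -> straight a b r -> a <= s <= b -> derive1 r s = derive1 r a.
Proof.
move=> sr st sab; apply/rowP => j.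
apply: (derive1_eq0_cst_itv _ (fun x => derive1 r x ord0 j) a b) => // x xab.
have dr : derivable (derive1 r) x 1.
  exact: smooth_on_derivable (smooth_on_derive1n _ _ _ _ 1 sr) xab.
have := is_derive_coord _ _ _ _ j dr.
by have := st _ xab; rewrite /derive1n /= => ->; rewrite mxE.
Qed.

(** At [t = t0] the term in [d] vanishes for all [s], so the partial derivatives are [r'] and [d].
    The formula holds at every [s] and can therefore be used under a derivative in [s]. *)
Lemma surface_normal_ruled (R : realType) (r d : R -> 'rV[R]_3) (t0 s : R) :
  surface_normal (fun s t => r s + (t - t0) *: d s) s t0 =
  crossv (derive1 r s) (d s).
Proof.
rewrite /surface_normal /partial_s /partial_t.
have -> : (fun x => r x + (t0 - t0) *: d x) = r.
  by apply/funext => x; rewrite subrr scale0r addr0.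
have -> // : derive1 (fun t => r s + (t - t0) *: d s) t0 = d s.
apply: derive1_row => j.
rewrite (_ : (fun x => _) =
  (fun x => r s ord0 j + (x - t0) * d s ord0 j)); last first.
  by apply/funext => x; rewrite !mxE.
by apply: is_derive_eq; rewrite /GRing.scale /=; ring.
Qed.

(* Differentiating the normal [r' x d] along [r] and pairing it with [r']
   leaves [det (r'', d, r')]. *)
Lemma asymptotic_curve_ruled (R : realType) (a b t0 : R) (r d : R -> 'rV[R]_3) :
  smooth_on a b r -> smooth_on a b d ->
  (forall s, a <= s <= b ->
     dotv (crossv (derive1n 2 r s) (d s)) (derive1 r s) = 0) ->
  asymptotic_curve a b t0 (fun s t => r s + (t - t0) *: d s) r.
Proof.
move=> sr sd det0; split=> s sab; first by rewrite subrr scale0r addr0.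
rewrite /partial_s (_ : (fun x => _) = fun x => crossv (derive1 r x) (d x)).
  rewrite derive1_crossv; first last.
  - exact: smooth_on_derivable sd sab.
  - exact: smooth_on_derivable (smooth_on_derive1n _ _ _ _ 1 sr) sab.
  (* The other term of the product rule, [r' x d'], is orthogonal to [r']. *)
  by rewrite dotvC dotvDr -!(dotvC _ _ (derive1 r s)) dotv_crossvl det0 // addr0.
by apply/funext => x; rewrite surface_normal_ruled.
Qed.

Theorem theorem4p1 (R : realType) (L1 L2 : R) (hL : L1 < L2)
    (r : R -> 'rV[R]_3)
    (hreg : regular_curve L1 L2 r)
    (harc : arc_length_param L1 L2 r) :
  exists (t0 : R) (P : R -> R -> 'rV[R]_3),
    [/\ ruled_surface L1 L2 r t0 P,
        asymptotic_curve L1 L2 t0 P r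
      & nondegenerate_along L1 L2 t0 P r].
Proof.
have [sr r'0] := hreg.
(* All requirements become conditions on the direction [d] alone; the offset [t0] is arbitrary and
   is set to 0. *)
suff [d [sd d0 det0 nd]] : exists d : R -> 'rV[R]_3,
    [/\ smooth_on L1 L2 d, forall s, L1 <= s <= L2 -> d s != 0,
        forall s, L1 <= s <= L2 ->
          dotv (crossv (derive1n 2 r s) (d s)) (derive1 r s) = 0
      & forall s, L1 <= s <= L2 -> straight L1 L2 r \/ derive1n 2 r s != 0 ->
          crossv (derive1 r s) (d s) != 0].
  exists 0, (fun s t => r s + (t - 0) *: d s); split.
  - by exists d.
  - exact: asymptotic_curve_ruled.
  - by move=> s sab h; rewrite surface_normal_ruled; exact: nd.
have [st|nst] := pselect (straight L1 L2 r).
- have aab : L1 <= L1 <= L2 by lra.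
  (* [v] is not parallel to the tangent at [L1], which is the tangent on all of [[L1, L2]]. *)
  have [v nv] := exists_crossv_neq0 _ _ (r'0 _ aab).
  exists (fun=> v); split.
  + exact: smooth_on_cst.
  + move=> _ _; apply: contraNneq nv => ->.
    by rewrite crossvC crossv0l oppr0.
  + by move=> s sab; rewrite st // crossv0l dotvC dotv0.
  + by move=> s sab _; rewrite (straight_derive1 _ _ _ _ _ sr st sab).
have orth s : L1 <= s <= L2 -> dotv (derive1 r s) (derive1n 2 r s) = 0.
  exact: arc_length_dotv_derive2.
exists (fun s => derive1 r s + derive1n 2 r s); split.
- apply: smooth_on_add; first exact: (smooth_on_derive1n _ _ _ _ 1).
  exact: smooth_on_derive1n.
(* Pairing [d = 0] with [r'] would give [1 = 0]. *)
- move=> s sab; apply: contra_neq (oner_neq0 R) => d0.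
  have := congr1 (dotv (derive1 r s)) d0.
  by rewrite dotvDr orth // addr0 (arc_length_dotv _ _ _ _ _ harc) // dotv0.
(* Here [r'' x d = r'' x r'], which is orthogonal to [r']. *)
- move=> s sab; rewrite crossvDr crossvv addr0 crossvC -scaleN1r.
  by rewrite /dotv -scalemxAl mxE -/(dotv _ _) dotv_crossvl mulr0.
- move=> s sab [//|r2]; rewrite crossvDr crossvv add0r.
  apply: crossv_orthogonal_neq0; [exact: r'0|exact: r2|exact: orth].
Qed.
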